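(* Let $\mathcal H$ be an infinite-dimensional separable Hilbert space. Assume that $\{f_k\}_{k=1}^\infty$ is an overcomplete frame for $\mathcal H$ and that $\{f_k\}_{k=1}^\infty=\{T^n\varphi\}_{n=0}^\infty$ (i.e. $f_{n+1}=T^n\varphi$ for all $n\ge0$) for some $\varphi\in\mathcal H$ and some bounded linear operator $T:\mathcal H\to\mathcal H$. Then there exists an $N\in\mathbb N$ such that $$\{f_k\}_{k=1}^N\cup\{f_k\}_{k=N+\ell}^\infty$$ is a frame for $\mathcal H$ for all $\ell\in\mathbb N$.
   Context: $\mathbb N=\{1,2,3,\dots\}$. A countable family $\{f_k\}_{k\in I}$ in $\mathcal H$ is a frame for $\mathcal H$ if there exist constants $A,B>0$ such that $A\|f\|^2\le\sum_{k\in I}|\langle f,f_k\rangle|^2\le B\|f\|^2$ for all $f\in\mathcal H$. A frame $\{f_k\}_{k=1}^\infty$ is a Riesz basis if and only if it is $\omega$-independent, i.e. $\sum_{k=1}^\infty c_kf_k=0$ only if $c_k=0$ for all $k$; a frame is overcomplete if it is not a Riesz basis, equivalently if there is a nonzero $\{c_k\}_{k=1}^\infty\in\ell^2(\mathbb N)$ with $\sum_{k=1}^\infty c_kf_k=0$. *)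

(* Defs.v *)
From HB Require Import structures.
From mathcomp Require Import all_boot all_order all_algebra.
From mathcomp Require Import sesquilinear complex.
From mathcomp Require Import all_classical all_reals all_analysis.

Set Implicit Arguments.
Unset Strict Implicit.
Unset Printing Implicit Defensive.

Import Order.TTheory GRing.Theory Num.Theory.
Import numFieldNormedType.Exports.

Local Open Scope classical_set_scope.
Local Open Scope ring_scope.

(* A Hilbert space may be complex (cplx = true) or real (cplx = false). *)
Definition scalars (R : realType) (cplx : bool) : numFieldType :=
  if cplx then (R[i] : numFieldType) else (R : numFieldType).

Definition scalar_conj (R : realType) (cplx : bool) :
    scalars R cplx -> scalars R cplx :=
  if cplx as b return scalars R b -> scalars R b
  then (fun z : R[i] => Num.conj z) else idfun.

Section Spaces.
Context {K : numFieldType} {H : normedModType K}.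

(* {dot H for theta} is linear in its first argument and theta-linear in the
   second; together with completeness of H this is a Hilbert space. *)
Definition induces_norm (theta : K -> K) (ip : {dot H for theta}) : Prop :=
  forall x : H, `|x| ^+ 2 = ip x x.

Definition infinite_dimensional : Prop :=
  ~ exists (n : nat) (e : 'I_n -> H),
      forall x, exists c : 'I_n -> K, x = \sum_(i < n) c i *: e i.

Definition separable : Prop :=
  exists2 D : set H, countable D & dense D.

Definition bounded_operator (T : H -> H) : Prop :=
  exists M : K, forall x, `|T x| <= M * `|x|.

End Spaces.

Arguments infinite_dimensional {K} H.
Arguments separable {K} H.

(* The families below are {f k}_{k \in I} for a set I of natural numbers; the
   values of f outside I are irrelevant.  For complex scalars the order is partial:
   0 < A and x <= y entail that A and y - x are real. *)
Section Families.
Context {K : numFieldType} {H : normedModType K} {theta : K -> K}.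
Variables (ip : {dot H for theta}) (I : pred nat) (f : nat -> H).

Definition is_frame : Prop :=
  exists A B : K, [/\ 0 < A, 0 < B &
    forall x : H, exists2 s : K,
      (fun n => \sum_(0 <= k < n | I k) `|ip x (f k)| ^+ 2) @ \oo --> s &
      A * `|x| ^+ 2 <= s <= B * `|x| ^+ 2].

Definition linear_span : set H :=
  [set x | exists (n : nat) (c : nat -> K),
     x = \sum_(0 <= k < n | I k) c k *: f k].

Definition riesz_basis : Prop :=
  closure linear_span = setT /\
  exists A B : K, [/\ 0 < A, 0 < B &
    forall (n : nat) (c : nat -> K),
      A * (\sum_(0 <= k < n | I k) `|c k| ^+ 2)
        <= `|\sum_(0 <= k < n | I k) c k *: f k| ^+ 2
        <= B * (\sum_(0 <= k < n | I k) `|c k| ^+ 2)].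

Definition overcomplete_frame : Prop := is_frame /\ ~ riesz_basis.

End Families.

(* Main.v *)
Require Import Defs.
From HB Require Import structures.
From mathcomp Require Import all_boot all_order all_algebra.
From mathcomp Require Import sesquilinear complex.
From mathcomp Require Import all_classical all_reals all_analysis.
From mathcomp Require Import ring zify.

Set Implicit Arguments.
Unset Strict Implicit.
Unset Printing Implicit Defensive.

Import Order.TTheory GRing.Theory Num.Theory.
Import numFieldNormedType.Exports.

Local Open Scope classical_set_scope.
Local Open Scope ring_scope.

(** Why the theorem is true.

    Let S x = sum_k <x, f_k> f_k be the frame operator.  It is onto, so every f_m
    has some g_m with S g_m = f_m, that is f_m = sum_k <g_m, f_k> f_k with square
    summable coefficients ([frame_expansion_ex]).  If <g_m, f_k> were 1 for k = m
    and 0 otherwise, for all m and k, then pairing x = sum_k c_k f_k with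
    y = sum_k c_k g_k would give <x, y> = sum_k |c_k|^2, while the lower frame
    bound gives A |y|^2 <= sum_k |c_k|^2; Cauchy-Schwarz then yields the lower
    Riesz bound, and the family would be a Riesz basis
    ([riesz_of_biorthogonal]).

    For an overcomplete frame the coefficients <g_m, f_k> - delta_mk are therefore
    not all zero, and they form a nontrivial square summable relation
    sum_k c_k f_k = 0.  Solving it for the term of least index N with c_N <> 0
    expresses f_N through the later elements: f_N = sum_(k > N) e_k f_k
    ([overcomplete_tail_expansion]).

    Applying the bounded operator T^j, which sends f_k to f_(k+j), gives
    f_(N+j) = sum_(k > N+j) e_(k-j) f_k with the same square sum
    ([tail_expansion_shift]).  An element that is a square summable combination of
    the other members of a frame can be dropped, because then
    |<x, f_m>|^2 <= E sum_(k <> m) |<x, f_k>|^2 ([is_frame_remove]).  Dropping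
    f_(N+1), f_(N+2), ... in turn proves the theorem: the expansion of each uses
    only later elements, which are still present.

    Real and complex spaces are treated together, over an archimedean field K
    with a map theta such that z * theta z = |z|^2 and |theta z| = |z|.  The order of
    K may be partial, so inequalities are obtained from explicitly nonnegative
    terms, and limits of inequalities from the continuity of the norm. *)

(** * Limits over a numeric field *)

(** The constant C may be any scalar of K: [C * `|b - v n|] is nonnegative as soon
    as the hypothesis holds, so C can be replaced with its norm. *)
Lemma lipschitz_cvg (K : numFieldType) (U V : normedModType K)
    (u : nat -> U) (v : nat -> V) (a : U) (b : V) (C : K) :
  (forall n, `|a - u n| <= C * `|b - v n|) ->
  v @ \oo --> b -> u @ \oo --> a.
Proof.
move=> uv /cvgrPdist_lt vb; apply/cvgrPdist_lt => e e0.
have C1 : 0 < `|C| + 1 by rewrite ltr_wpDl.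
have := vb (e / (`|C| + 1)); rewrite divr_gt0// => /(_ isT).
apply: filterS => n; rewrite ltr_pdivlMr// => vn.
have C_ge0 : 0 <= C * `|b - v n| by rewrite (le_trans _ (uv n)).
rewrite (le_lt_trans (uv n))// -(ger0_norm C_ge0) normrM normr_id.
by rewrite (le_lt_trans _ vn)// [leRHS]mulrC ler_wpM2r// lerDl.
Qed.

Lemma eq_cvgn (T : topologicalType) (u v : nat -> T) (l : T) :
  u =1 v -> u @ \oo --> l -> v @ \oo --> l.
Proof. by move=> /funext ->. Qed.

Lemma cvgn_unique (K : numFieldType) (V : pseudoMetricNormedZmodType K)
    (u : nat -> V) (a b : V) : u @ \oo --> a -> u @ \oo --> b -> a = b.
Proof. by move=> ua ub; exact: norm_cvg_unique ua ub. Qed.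

(** In a partially ordered K the nonnegative elements are those equal to their
    norm, a condition preserved by limits because the norm is continuous. *)
Lemma cvg_ge0 (K : numFieldType) (u : nat -> K) (l : K) :
  (forall n, 0 <= u n) -> u @ \oo --> l -> 0 <= l.
Proof.
move=> u0 ul; rewrite -[l](_ : `|l| = l) ?normr_ge0//.
apply: (@norm_cvg_unique K K (u @ \oo)) => //.
have := cvg_comp _ _ ul (@norm_continuous K K l).
by apply: cvg_trans; apply: near_eq_cvg; near=> n; rewrite /= ger0_norm.
Unshelve. all: by end_near. Qed.

Lemma cvg_le_bound (K : numFieldType) (u : nat -> K) (l b : K) :
  (forall n, u n <= b) -> u @ \oo --> l -> l <= b.
Proof.
move=> ub ul; rewrite -subr_ge0; apply: (@cvg_ge0 _ (fun n => b - u n)).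
  by move=> n; rewrite subr_ge0.
by apply: cvgB => //; exact: cvg_cst.
Qed.

Lemma le_cvg_nondecreasing (K : numFieldType) (u : nat -> K) (l : K) n :
  (forall m p, (m <= p)%N -> u m <= u p) -> u @ \oo --> l -> u n <= l.
Proof.
move=> ndu ul; rewrite -subr_ge0.
apply: (@cvg_ge0 _ (fun p => u (p + n)%N - u n)).
  by move=> p; rewrite subr_ge0 ndu// leq_addl.
by apply: cvgB; [rewrite cvg_shiftn|exact: cvg_cst].
Qed.

Lemma cauchy_seq_cvg (K : numFieldType) (V : completeNormedModType K)
    (u : nat -> V) :
  (forall e : K, 0 < e -> exists N : nat, forall m n : nat,
     (N <= m)%N -> (m <= n)%N -> `|u n - u m| < e) ->
  exists l : V, u @ \oo --> l.
Proof.
move=> u_cauchy; apply/cvg_ex/cauchy_cvgP/cauchy_ballP => e /u_cauchy[N uN].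
near_simpl; exists ([set n | (N <= n)%N], [set n | (N <= n)%N]).
  by split; exists N.
move=> [m n]/= [Nm Nn]; rewrite -ball_normE/=.
have [mn|/ltnW nm] := leqP m n; last exact: uN.
by rewrite distrC; apply: uN.
Qed.

Lemma cvg_cauchy_seq (K : numFieldType) (V : normedModType K)
    (u : nat -> V) (l : V) (e : K) : u @ \oo --> l -> 0 < e ->
  exists N : nat, forall m n : nat,
    (N <= m)%N -> (m <= n)%N -> `|u n - u m| < e.
Proof.
move=> /cvgrPdist_lt ul e0.
have [|N _ uN] := ul (e / 2); first by rewrite divr_gt0.
exists N => m n Nm mn; apply: (@distm_lt_split _ _ l).
  by rewrite distrC; apply: uN => /=; exact: leq_trans mn.
exact: uN.
Qed.

Lemma cvg_step (K : numFieldType) (V : normedModType K) (a : V) m :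
  (fun n => if (m < n)%N then a else 0) @ \oo --> a.
Proof. by apply: cvg_near_cst; exists m.+1 => // n /= ->. Qed.

Lemma bounded_operator_cvg (K : numFieldType) (H : normedModType K)
    (T : {linear H -> H}) (u : nat -> H) (l : H) :
  bounded_operator T -> u @ \oo --> l -> (fun n => T (u n)) @ \oo --> T l.
Proof.
move=> [M TM] ul; apply: (lipschitz_cvg _ ul (C := M)) => n.
by rewrite -raddfB; exact: TM.
Qed.

(** * Finite sums *)

Lemma sum_delta (V : zmodType) (I : pred nat) (F : nat -> V) m n : I m ->
  \sum_(0 <= k < n | I k && (k == m)) F k = if (m < n)%N then F m else 0.
Proof.
move=> Im; transitivity (\sum_(0 <= k < n | k == m) F k).
  2: by rewrite big_nat1_eq.
apply: eq_bigl => k.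
by case: eqP => [->|]; rewrite ?Im ?andbF.
Qed.

Lemma sum_sqr_sub_le (K : numFieldType) (I : pred nat) (a b : nat -> K)
    (n : nat) :
  \sum_(0 <= k < n | I k) `|a k - b k| ^+ 2 <=
  2 * \sum_(0 <= k < n | I k) `|a k| ^+ 2 +
  2 * \sum_(0 <= k < n | I k) `|b k| ^+ 2.
Proof.
rewrite !mulr_sumr -big_split/=; apply: ler_sum => k _.
apply: (@le_trans _ _ ((`|a k| + `|b k|) ^+ 2)).
  by rewrite lerXn2r ?nnegrE ?addr_ge0// ler_normB.
rewrite -subr_ge0.
have -> : 2 * `|a k| ^+ 2 + 2 * `|b k| ^+ 2 - (`|a k| + `|b k|) ^+ 2 =
    (`|a k| - `|b k|) ^+ 2 by ring.
by rewrite real_exprn_even_ge0// rpredB// ger0_real.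
Qed.

(** With p, q the two sums of squares and c the sum of the [`|a k| * `|b k|], the
    sum of the squares of [q * `|a k| - c * `|b k|] is [q * (q * p - c ^+ 2)]. *)
Lemma cauchy_schwarz_sum (K : numFieldType) (r : seq nat) (P : pred nat)
    (a b : nat -> K) :
  `|\sum_(k <- r | P k) a k * b k| ^+ 2 <=
  (\sum_(k <- r | P k) `|a k| ^+ 2) * (\sum_(k <- r | P k) `|b k| ^+ 2).
Proof.
set p := \sum_(k <- r | P k) `|a k| ^+ 2.
set q := \sum_(k <- r | P k) `|b k| ^+ 2.
pose c := \sum_(k <- r | P k) `|a k| * `|b k|.
have p0 : 0 <= p by apply: sumr_ge0 => k _; rewrite exprn_ge0.
have q0 : 0 <= q by apply: sumr_ge0 => k _; rewrite exprn_ge0.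
have c0 : 0 <= c by apply: sumr_ge0 => k _; rewrite mulr_ge0.
apply: (@le_trans _ _ (c ^+ 2)).
  rewrite lerXn2r ?nnegrE// (le_trans (ler_norm_sum _ _ _))//.
  by apply: ler_sum => k _; rewrite normrM.
have : 0 <= \sum_(k <- r | P k) (q * `|a k| - c * `|b k|) ^+ 2.
  apply: sumr_ge0 => k _; rewrite real_exprn_even_ge0//.
  by rewrite rpredB// rpredM// ger0_real.
have -> : \sum_(k <- r | P k) (q * `|a k| - c * `|b k|) ^+ 2 =
    q * (q * p - c ^+ 2).
  under eq_bigr do rewrite sqrrB !exprMn.
  rewrite big_split/= sumrB -!mulr_sumr -/p -/q.
  rewrite (eq_bigr (fun k => (q * c *+ 2) * (`|a k| * `|b k|))); last first.
    by move=> k _; ring.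
  rewrite -mulr_sumr -/c; ring.
move: q0; rewrite le_eqVlt => /predU1P[q_eq0 _|q_gt0]; last first.
  by rewrite pmulr_rge0// subr_ge0 mulrC.
suff -> : c = 0 by rewrite expr0n/= mulr_ge0// -q_eq0.
rewrite /c big_seq_cond big1// => k /andP[kr Pk].
suff : `|b k| ^+ 2 == 0 by rewrite sqrf_eq0 => /eqP ->; rewrite mulr0.
move/esym/eqP : q_eq0; rewrite psumr_eq0 => [/allP/(_ _ kr)/implyP/(_ Pk)//|i _].
by rewrite exprn_ge0.
Qed.

(** * Sesquilinear inner products *)

Section InnerProduct.
Context {K : numFieldType} {theta : K -> K} {H : normedModType K}.
Variable ip : {dot H for theta}.
Hypothesis ip_norm : induces_norm ip.
Hypothesis theta_mul : forall z, z * theta z = `|z| ^+ 2.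
Hypothesis theta_norm : forall z, `|theta z| = `|z|.

Lemma ipC x y : ip x y = theta (ip y x).
Proof. by rewrite hermitian_subproof expr0 mul1r. Qed.

Lemma normr_ipC x y : `|ip x y| = `|ip y x|.
Proof. by rewrite ipC theta_norm. Qed.

Lemma ipDl x y z : ip (x + y) z = ip x z + ip y z.
Proof. exact: linearDl. Qed.

Lemma ipBl x y z : ip (x - y) z = ip x z - ip y z.
Proof. exact: linearBl. Qed.

Lemma ipBr x y z : ip z (x - y) = ip z x - ip z y.
Proof. exact: linearBr. Qed.

Lemma ipZl a x y : ip (a *: x) y = a * ip x y.
Proof. by rewrite linearZl_LR. Qed.

Lemma ip_suml (r : seq nat) (P : pred nat) (F : nat -> H) y :
  ip (\sum_(k <- r | P k) F k) y = \sum_(k <- r | P k) ip (F k) y.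
Proof. exact: linear_sumlz. Qed.

Lemma ip_sumr (r : seq nat) (P : pred nat) (F : nat -> H) y :
  ip y (\sum_(k <- r | P k) F k) = \sum_(k <- r | P k) ip y (F k).
Proof. exact: linear_sumr. Qed.

Lemma ipZr a x y : ip x (a *: y) = theta a * ip x y.
Proof. by rewrite linearZr_LR. Qed.

(** The vector z = |y|^2 x - <x, y> y is orthogonal to y, and its squared norm is
    |y|^2 (|x|^2 |y|^2 - |<x, y>|^2). *)
Lemma cauchy_schwarz_ip x y : `|ip x y| ^+ 2 <= `|x| ^+ 2 * `|y| ^+ 2.
Proof.
have [->|y0] := eqVneq y 0; first by rewrite linear0r !normr0 expr0n mulr0.
have y_gt0 : 0 < `|y| ^+ 2 by rewrite exprn_gt0// normr_gt0.
rewrite -subr_ge0 -(pmulr_rge0 _ y_gt0).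
have [z zE] : exists z, z = `|y| ^+ 2 *: x - ip x y *: y by eexists.
suff -> : `|y| ^+ 2 * (`|x| ^+ 2 * `|y| ^+ 2 - `|ip x y| ^+ 2) = `|z| ^+ 2.
  by rewrite exprn_ge0.
have zy : ip z y = 0.
  by rewrite zE ipBl !ipZl -ip_norm mulrC subrr.
rewrite (ip_norm z) {2}zE ipBr !ipZr zy mulr0 subr0.
rewrite zE ipBl !ipZl -ip_norm (ipC y x) theta_mul.
have := theta_mul (`|y| ^+ 2).
rewrite [X in _ = X ^+ 2]ger0_norm; last exact: ltW.
rewrite expr2 => /(mulfI (lt0r_neq0 y_gt0)) ->.
by rewrite [`|x| ^+ 2 * _]mulrC.
Qed.

Lemma normr_ip_le x y : `|ip x y| <= `|x| * `|y|.
Proof.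
by rewrite -(@ler_pXn2r _ 2)// ?nnegrE ?mulr_ge0// exprMn cauchy_schwarz_ip.
Qed.

Lemma cvg_ipl (u : nat -> H) x y :
  u @ \oo --> x -> (fun n => ip (u n) y) @ \oo --> ip x y.
Proof.
apply: (@lipschitz_cvg K K^o H _ _ _ _ `|y|) => n.
by rewrite -ipBl mulrC normr_ip_le.
Qed.

Lemma cvg_ipr (u : nat -> H) x y :
  u @ \oo --> x -> (fun n => ip y (u n)) @ \oo --> ip y x.
Proof.
by apply: (@lipschitz_cvg K K^o H _ _ _ _ `|y|) => n; rewrite -ipBr normr_ip_le.
Qed.

End InnerProduct.

(** * The frame operator is onto *)

Section FrameOperator.
Context {K : numFieldType} {theta : K -> K} {H : completeNormedModType K}.
Variable ip : {dot H for theta}.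
Hypothesis ip_norm : induces_norm ip.
Hypothesis theta_mul : forall z, z * theta z = `|z| ^+ 2.
Hypothesis theta_norm : forall z, `|theta z| = `|z|.
Hypothesis K_archi : forall x : K, 0 < x -> exists n : nat, x < n%:R.
Variables (I : pred nat) (f : nat -> H) (A B : K) (s : H -> K).
Hypotheses (A_gt0 : 0 < A) (B_gt0 : 0 < B).
Hypothesis s_cvg : forall x : H,
  (fun n => \sum_(0 <= k < n | I k) `|ip x (f k)| ^+ 2) @ \oo --> s x.
Hypothesis s_ge : forall x : H, A * `|x| ^+ 2 <= s x.
Hypothesis s_le : forall x : H, s x <= B * `|x| ^+ 2.

Lemma sum_le_frame_sum x m n :
  \sum_(m <= k < n | I k) `|ip x (f k)| ^+ 2 <= s x.
Proof.
apply: (@le_trans _ _ (\sum_(0 <= k < n | I k) `|ip x (f k)| ^+ 2)).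
  have [mn|/ltnW nm] := leqP m n; last first.
    by rewrite [leLHS]big_geq// sumr_ge0// => k _; rewrite exprn_ge0.
  rewrite [leRHS](big_cat_nat (leq0n m) mn)/= lerDr.
  by rewrite sumr_ge0// => k _; rewrite exprn_ge0.
apply: (@le_cvg_nondecreasing _ _ _ n _ (@s_cvg x)) => p q pq.
by rewrite (big_cat_nat (leq0n p) pq)/= lerDl sumr_ge0// => k _; rewrite exprn_ge0.
Qed.

(** The synthesis map is the adjoint of the analysis map x |-> (<x, f_k>)_k, so it
    inherits its bound B: writing x for the combination, |x|^4 is the square of
    sum_k c_k <f_k, x>, at most (sum_k |c_k|^2) B |x|^2. *)
Lemma bessel_synthesis (c : nat -> K) m n :
  `|\sum_(m <= k < n | I k) c k *: f k| ^+ 2 <=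
  B * \sum_(m <= k < n | I k) `|c k| ^+ 2.
Proof.
set x := \sum_(m <= k < n | I k) c k *: f k.
have [->|x0] := eqVneq x 0.
  rewrite normr0 expr0n/=; apply: mulr_ge0; first exact: ltW.
  by apply: sumr_ge0 => k _; rewrite exprn_ge0.
have x_gt0 : 0 < `|x| ^+ 2 by rewrite exprn_gt0// normr_gt0.
rewrite -(ler_pM2l x_gt0) -[leLHS]expr2.
have x2E : `|x| ^+ 2 = `|\sum_(m <= k < n | I k) c k * ip (f k) x|.
  rewrite -[LHS]ger0_norm ?exprn_ge0// ip_norm {1}/x ip_suml; congr `|_|.
  by apply: eq_bigr => k _; rewrite ipZl.
rewrite {1}x2E (le_trans (cauchy_schwarz_sum _ _ _ _))//.
rewrite mulrA [leRHS]mulrC [`|x| ^+ 2 * B]mulrC.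
apply: ler_wpM2l; first by apply: sumr_ge0 => k _; rewrite exprn_ge0.
rewrite (le_trans _ (s_le x))//.
under eq_bigr do rewrite normr_ipC//.
exact: sum_le_frame_sum.
Qed.

(** The partial sums are Cauchy: by the Bessel bound on synthesis, their
    increments are controlled by those of the convergent series
    sum_k |<x, f_k>|^2. *)
Lemma frame_operator_ex x : exists Sx : H,
  (fun n => \sum_(0 <= k < n | I k) ip x (f k) *: f k) @ \oo --> Sx.
Proof.
apply: cauchy_seq_cvg => e e0.
have [|N sN] := cvg_cauchy_seq (@s_cvg x) (e := e ^+ 2 / B).
  by rewrite divr_gt0// exprn_gt0.
exists N => m n Nm mn; have := sN _ _ Nm mn.
rewrite !(big_cat_nat (leq0n m) mn)/= !(addrC (\sum_(0 <= i < m | I i) _)) !addrK.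
rewrite ger0_norm; last by apply: sumr_ge0 => k _; rewrite exprn_ge0.
rewrite ltr_pdivlMr// mulrC => lt_e.
rewrite -(@ltr_pXn2r _ 2)// ?nnegrE ?(ltW e0)//.
exact: le_lt_trans (bessel_synthesis _ _ _) lt_e.
Qed.

Definition frame_operator x : H := projT1 (cid (frame_operator_ex x)).
Local Notation S := frame_operator.

Lemma frame_operator_cvg x :
  (fun n => \sum_(0 <= k < n | I k) ip x (f k) *: f k) @ \oo --> S x.
Proof. by rewrite /frame_operator; case: cid. Qed.

Lemma frame_operator_unique x y :
  (fun n => \sum_(0 <= k < n | I k) ip x (f k) *: f k) @ \oo --> y -> S x = y.
Proof. by move=> xy; exact: cvgn_unique (@frame_operator_cvg x) xy. Qed.

Lemma frame_operatorP a x y : S (a *: x + y) = a *: S x + S y.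
Proof.
apply: frame_operator_unique.
apply: (eq_cvgn _ (cvgD (cvgZl_tmp (k := a) (@frame_operator_cvg x))
                        (@frame_operator_cvg y))) => n /=.
rewrite !fctE /= scaler_sumr -big_split/=; apply: eq_bigr => k _.
by rewrite ipDl ipZl scalerDl scalerA.
Qed.

Lemma ip_frame_operator x : ip (S x) x = s x.
Proof.
apply: (cvgn_unique _ (@s_cvg x)).
apply: (eq_cvgn _ (cvg_ipl ip_norm theta_mul (y := x)
                          (@frame_operator_cvg x))) => n /=.
rewrite ip_suml; apply: eq_bigr => k _.
by rewrite ipZl (ipC _ (f k)) theta_mul.
Qed.

Lemma ip_frame_operatorC x : ip x (S x) = s x.
Proof.
apply: (cvgn_unique _ (@s_cvg x)).
apply: (eq_cvgn _ (cvg_ipr ip_norm theta_mul (y := x)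
                          (@frame_operator_cvg x))) => n /=.
rewrite ip_sumr; apply: eq_bigr => k _.
by rewrite ipZr mulrC theta_mul.
Qed.

Lemma frame_operator_sqr_le x : `|S x| ^+ 2 <= B * s x.
Proof.
have := cvg_comp _ _ (@frame_operator_cvg x) (@norm_continuous K H (S x)).
move=> Sn; apply: (cvg_le_bound _ (cvgM Sn Sn)) => n.
rewrite -[leLHS]expr2.
apply: (le_trans (bessel_synthesis _ _ _)).
by rewrite ler_wpM2l ?(ltW B_gt0)// sum_le_frame_sum.
Qed.

Lemma frame_operator_le x : `|S x| <= B * `|x|.
Proof.
rewrite -(@ler_pXn2r _ 2)// ?nnegrE ?mulr_ge0 ?(ltW B_gt0)//.
rewrite (le_trans (frame_operator_sqr_le x))//.
by rewrite exprMn expr2 -mulrA ler_wpM2l ?(ltW B_gt0).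
Qed.

Lemma frame_operator_ge x : A * `|x| <= `|S x|.
Proof.
have [->|x0] := eqVneq x 0; first by rewrite normr0 mulr0.
have x_gt0 : 0 < `|x| by rewrite normr_gt0.
rewrite -(ler_pM2r x_gt0) -mulrA -expr2 (le_trans (s_ge x))//.
rewrite -ip_frame_operator.
rewrite (le_trans _ (normr_ip_le ip_norm theta_mul _ _))//.
rewrite ger0_norm// ip_frame_operator (le_trans _ (s_ge x))//.
by rewrite mulr_ge0 ?(ltW A_gt0)// exprn_ge0.
Qed.

(** Richardson iteration for the equation S y = x, started at y = 0: [residual x n]
    is what is left of x after n steps. *)
Fixpoint residual x n : H :=
  if n is m.+1 then residual x m - B^-1 *: S (residual x m) else x.

(** Expand the square and use <S x, x> = <x, S x> = s x and |S x|^2 <= B s x; the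
    step size 1/B is the one for which the quadratic term absorbs only one of
    the two linear terms. *)
Lemma residual_step x :
  `|x - B^-1 *: S x| ^+ 2 <= `|x| ^+ 2 - B^-1 * s x.
Proof.
have theta_B : theta B^-1 = B^-1.
  have Bi0 : B^-1 != 0 by rewrite invr_eq0 gt_eqF.
  by apply: (mulfI Bi0); rewrite theta_mul ger0_norm ?expr2// invr_ge0 ltW.
rewrite ip_norm ipBl !ipBr !ipZl !ipZr theta_B ip_frame_operator
  ip_frame_operatorC -!ip_norm opprB addrA -subr_ge0.
have -> : `|x| ^+ 2 - B^-1 * s x -
    (`|x| ^+ 2 - B^-1 * s x + B^-1 * (B^-1 * `|S x| ^+ 2) - B^-1 * s x) =
    B^-1 * B^-1 * (B * s x - `|S x| ^+ 2).
  by field; rewrite gt_eqF.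
by rewrite !mulr_ge0 ?invr_ge0 ?(ltW B_gt0)// subr_ge0 frame_operator_sqr_le.
Qed.

(** Each step multiplies the squared norm by at most 1 - A/B.  The resulting
    geometric decay is stated in this weaker polynomial form because an
    archimedean scalar field suffices to deduce convergence from it. *)
Lemma residual_le x n : (1 + n%:R * (A / B)) * `|residual x n| ^+ 2 <= `|x| ^+ 2.
Proof.
have t0 : 0 <= A / B by rewrite divr_ge0 ?ltW.
elim: n => [|n]; first by rewrite mul0r addr0 mul1r.
apply: le_trans => /=.
set r := residual x n; set r' := r - _.
have r'_le : `|r'| ^+ 2 <= `|r| ^+ 2 - A / B * `|r| ^+ 2.
  rewrite (le_trans (residual_step r))// lerD2l lerN2.
  by rewrite mulrAC mulrC ler_wpM2l ?invr_ge0 ?(ltW B_gt0).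
have r2 : 0 <= `|r| ^+ 2 by rewrite exprn_ge0.
have r'_le2 : `|r'| ^+ 2 <= `|r| ^+ 2.
  by rewrite (le_trans r'_le)// lerBlDr lerDl mulr_ge0.
have nt0 : 0 <= 1 + n%:R * (A / B) by rewrite addr_ge0// mulr_ge0.
have -> : 1 + n.+1%:R * (A / B) = 1 + n%:R * (A / B) + A / B :> K.
  by rewrite -natr1 mulrDl mul1r addrA.
rewrite mulrDl.
apply: (le_trans (lerD (ler_wpM2l nt0 r'_le) (ler_wpM2l t0 r'_le2))).
rewrite -subr_ge0.
have -> : (1 + n%:R * (A / B)) * `|r| ^+ 2 -
    ((1 + n%:R * (A / B)) * (`|r| ^+ 2 - A / B * `|r| ^+ 2) +
      A / B * `|r| ^+ 2) = n%:R * (A / B) * (A / B * `|r| ^+ 2).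
  by ring.
by apply: mulr_ge0; apply: mulr_ge0.
Qed.

Lemma residual_cvg0 x : residual x @ \oo --> (0 : H).
Proof.
have t0 : 0 < A / B by rewrite divr_gt0.
(* The denominator of the bound |residual x n|^2 <= |x|^2 / (1 + n A / B). *)
have n0 n : 0 < 1 + n%:R * (A / B).
  by rewrite ltr_wpDr//; apply: mulr_ge0 => //; exact: ltW.
apply/cvgrPdist_lt => e e0.
have [x0|x0] := eqVneq x 0.
  near=> n; rewrite sub0r normrN.
  have /(_ n) := residual_le x; rewrite x0 normr0 expr0n/=.
  rewrite pmulr_rle0//.
  rewrite -x0 => r0; rewrite (_ : `|_| = 0)//.
  by apply/eqP; rewrite -sqrf_eq0 eq_le r0 exprn_ge0.
(* It suffices that n exceeds |x|^2 / ((A / B) e^2). *)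
have te0 : 0 < A / B * e ^+ 2 by rewrite mulr_gt0// exprn_gt0.
have [|N xN] := @K_archi (`|x| ^+ 2 / (A / B * e ^+ 2)).
  by rewrite divr_gt0// exprn_gt0// normr_gt0.
exists N => // n /= Nn; rewrite sub0r normrN.
rewrite -(@ltr_pXn2r _ 2)// ?nnegrE ?(ltW e0)//.
rewrite -(ltr_pM2l (n0 n)) (le_lt_trans (residual_le x n))//.
move: xN; rewrite ltr_pdivrMr//; move/lt_le_trans; apply.
rewrite mulrA ler_wpM2r ?exprn_ge0 ?(ltW e0)//.
rewrite (@le_trans _ _ (n%:R * (A / B)))// ?lerDr//.
by rewrite ler_wpM2r ?(ltW t0)// ler_nat.
Unshelve. all: by end_near. Qed.

(** Summing the residuals gives y_n with S y_n = x - residual x n.  Since S is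
    bounded below by A, the y_n are Cauchy because the residuals are; S is
    continuous, so their limit is a preimage of x. *)
Lemma frame_operator_surj x : exists y, S y = x.
Proof.
pose y n := B^-1 *: \sum_(0 <= j < n) residual x j.
have Sy n : S (y n) = x - residual x n.
  elim: n => [|n IHn].
    rewrite /y big_geq// scaler0 /= subrr.
    by have := frame_operatorP (-1) 0 0; rewrite scaler0 addr0 scaleN1r addNr.
  rewrite /y big_nat_recr//= scalerDr addrC frame_operatorP -/(y n) IHn.
  by rewrite opprB addrC addrA addrAC.
have Sy_sub m n : S (y n - y m) = residual x m - residual x n.
  rewrite -[y n - y m]addrC -scaleN1r frame_operatorP !Sy scaleN1r.
  by rewrite opprB addrA subrK.
have [l yl] : exists l : H, y @ \oo --> l.
  apply: cauchy_seq_cvg => e e0.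
  have [|N rN] := cvg_cauchy_seq (@residual_cvg0 x) (e := A * e).
    by rewrite mulr_gt0.
  exists N => m n Nm mn; rewrite -(ltr_pM2l A_gt0).
  by rewrite (le_lt_trans (frame_operator_ge _))// Sy_sub distrC rN.
have Sl : S \o y @ \oo --> S l.
  apply: (lipschitz_cvg _ yl (C := B)) => n /=.
  apply: le_trans (frame_operator_le _).
  by rewrite -[l - _]addrC -[in leRHS]scaleN1r frame_operatorP scaleN1r addrC.
have Sx : S \o y @ \oo --> x.
  apply: (lipschitz_cvg _ (@residual_cvg0 x) (C := 1)) => n /=.
  by rewrite Sy mul1r opprB addrC subrK sub0r normrN.
by exists l; exact: cvgn_unique Sl Sx.
Qed.

(** The coefficients, being of the form <y, f_k>, are square summable by the Bessel
    bound; density of the span alone would not give this. *)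
Lemma frame_expansion_ex (x : H) : exists y : H,
  (fun n => \sum_(0 <= k < n | I k) ip y (f k) *: f k) @ \oo --> x.
Proof.
have [y Sy] := frame_operator_surj x.
by exists y; have := @frame_operator_cvg y; rewrite Sy.
Qed.

End FrameOperator.

(** * Riesz bases, relations and removable elements *)

Section RieszDichotomy.
Context {K : numFieldType} {theta : K -> K} {H : completeNormedModType K}.
Variable ip : {dot H for theta}.
Hypothesis ip_norm : induces_norm ip.
Hypothesis theta_mul : forall z, z * theta z = `|z| ^+ 2.
Hypothesis theta_norm : forall z, `|theta z| = `|z|.
Hypothesis K_archi : forall x : K, 0 < x -> exists n : nat, x < n%:R.

(** Chooses the sum of |<x, f_k>|^2 as a function of x, the form in which the
    frame inequalities are used. *)
Lemma is_frame_sums (I : pred nat) (f : nat -> H) : is_frame ip I f ->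
  exists A B : K, exists s : H -> K, [/\ 0 < A, 0 < B,
    forall x : H,
      (fun n => \sum_(0 <= k < n | I k) `|ip x (f k)| ^+ 2) @ \oo --> s x,
    forall x : H, A * `|x| ^+ 2 <= s x &
    forall x : H, s x <= B * `|x| ^+ 2].
Proof.
move=> [A [B [A0 B0 frm]]].
have /choice[s sP] : forall x : H, exists t : K,
    (fun n => \sum_(0 <= k < n | I k) `|ip x (f k)| ^+ 2) @ \oo --> t /\
    A * `|x| ^+ 2 <= t <= B * `|x| ^+ 2.
  by move=> x; have [t] := frm x; exists t.
exists A, B, s; split=> // x; have [sx /andP[? ?]] := sP x => //.
Qed.

(** The span is dense by [frame_expansion_ex].  For the lower bound, with
    x = sum_k c_k f_k, y = sum_k c_k g_k and P = sum_k |c_k|^2, biorthogonality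
    gives <x, y> = P and sum_k |<y, f_k>|^2 = P.  Hence A |y|^2 <= P and
    P^2 <= |x|^2 |y|^2, so A P <= |x|^2. *)
Lemma riesz_of_biorthogonal (I : pred nat) (f g : nat -> H) :
  is_frame ip I f ->
  (forall m k, I m -> I k -> ip (g m) (f k) = (k == m)%:R) ->
  riesz_basis I f.
Proof.
move=> /is_frame_sums[A [B [s [A0 B0 s_cvg s_ge s_le]]]] gf; split.
  apply/seteqP; split=> // x _.
  have [y yx] := frame_expansion_ex ip_norm theta_mul theta_norm K_archi
    A0 B0 s_cvg s_ge s_le x.
  apply: (closed_cvg _ (@closed_closure _ (linear_span I f)) _ _ yx).
  apply: nearW => n; apply: subset_closure.
  by exists n, (fun k => ip y (f k)).
exists A, B; split=> // n c; apply/andP; split; last first.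
  exact: (bessel_synthesis ip_norm theta_norm B0 s_cvg s_le).
set P := \sum_(0 <= k < n | I k) _; set x := \sum_(0 <= k < n | I k) _ *: _.
have P0 : 0 <= P by apply: sumr_ge0 => k _; rewrite exprn_ge0.
pose y := \sum_(0 <= k < n | I k) c k *: g k.
have yf k : I k -> ip y (f k) = if (k < n)%N then c k else 0.
  move=> Ik; rewrite ip_suml -(sum_delta c n Ik) big_mkcondr/=.
  apply: eq_bigr => j Ij; rewrite ipZl gf// eq_sym.
  by case: ifP => _; rewrite ?mulr1 ?mulr0.
have xy : ip x y = P.
  rewrite ip_suml /P big_nat_cond [RHS]big_nat_cond.
  apply: eq_bigr => k /andP[/andP[_ kn] Ik].
  by rewrite ipZl ipC yf// kn theta_mul.
have sy : s y <= P.
  apply: (cvg_le_bound _ (s_cvg y)) => m.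
  rewrite (eq_bigr (fun k => if (k < n)%N then `|c k| ^+ 2 else 0)); last first.
    by move=> k Ik; rewrite yf//; case: ifP => // _; rewrite normr0 expr0n.
  have [mn|nm] := leqP m n.
    rewrite /P [leRHS](big_cat_nat (leq0n m) mn)/= -[leLHS]addr0 lerD//.
      apply: ler_sum => k _; case: ifP => // _; exact: exprn_ge0.
    by apply: sumr_ge0 => k _; rewrite exprn_ge0.
  rewrite (big_cat_nat (leq0n n) (ltnW nm))/= -[leRHS]addr0 lerD//.
    by apply: ler_sum => k _; case: ifP => // _; exact: exprn_ge0.
  rewrite big_nat_cond big1// => k /andP[/andP[nk _] _].
  by rewrite ltnNge nk.
have [->|Pn0] := eqVneq P 0; first by rewrite mulr0 exprn_ge0.
have P_gt0 : 0 < P by rewrite lt_def Pn0.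
have P2 : P ^+ 2 <= `|x| ^+ 2 * `|y| ^+ 2.
  rewrite -[P]ger0_norm// -xy.
  exact: (cauchy_schwarz_ip ip_norm theta_mul).
rewrite -(ler_pM2r P_gt0) -mulrA -expr2.
apply: (le_trans (ler_wpM2l (ltW A0) P2)).
rewrite mulrCA ler_wpM2l ?exprn_ge0//.
exact: le_trans (s_ge y) sy.
Qed.

(** Square summability is part of the definition: it is what makes f_m removable
    from a frame. *)
Definition tail_expansion (I : pred nat) (f : nat -> H) (m : nat) : Prop :=
  exists (e : nat -> K) (E : K),
    (forall n, \sum_(0 <= k < n | I k && (m < k)%N) `|e k| ^+ 2 <= E) /\
    (fun n => \sum_(0 <= k < n | I k && (m < k)%N) e k *: f k) @ \oo --> f m.

(** Solve the relation for its first nonzero term. *)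
Lemma tail_expansion_of_relation (I : pred nat) (f : nat -> H)
    (c : nat -> K) (E : K) :
  (forall n, \sum_(0 <= k < n | I k) `|c k| ^+ 2 <= E) ->
  (fun n => \sum_(0 <= k < n | I k) c k *: f k) @ \oo --> (0 : H) ->
  (exists2 k, I k & c k != 0) ->
  exists2 m, I m & tail_expansion I f m.
Proof.
move=> cE c0 [k0 Ik0 ck0].
have ex_c : exists k, I k && (c k != 0) by exists k0; rewrite Ik0.
case: (ex_minnP ex_c) => m /andP[Im cm] m_min; exists m => //.
exists (fun k => - (c m)^-1 * c k), (`|(c m)^-1| ^+ 2 * E); split.
  move=> n; under eq_bigr do rewrite normrM exprMn normrN.
  rewrite -mulr_sumr ler_wpM2l ?exprn_ge0// (le_trans _ (cE n))//.
  rewrite [leRHS](bigID (fun k => (m < k)%N))/= lerDl.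
  by apply: sumr_ge0 => k _; rewrite exprn_ge0.
have -> : f m = - (c m)^-1 *: (0 - c m *: f m).
  by rewrite sub0r scalerN scaleNr opprK scalerA mulVf// scale1r.
apply: (eq_cvgn _ (cvgZl_tmp (k := - (c m)^-1)
  (cvgB c0 (@cvg_step K H (c m *: f m) m)))) => n.
under eq_bigr do rewrite -scalerA.
rewrite -scaler_sumr; congr (_ *: _).
rewrite !fctE (bigID (fun k => k == m))/= sum_delta// addrC addKr.
rewrite big_mkcond [RHS]big_mkcond/=; apply: eq_bigr => k _.
case Ik : (I k) => //=; case: ltngtP => //= km.
have [->|ck] := eqVneq (c k) 0; first by rewrite scale0r.
by have := m_min k; rewrite Ik ck leqNgt km => /(_ isT).
Qed.

(** With S g_m = f_m, the family (g_m) is not biorthogonal to (f_k), since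
    otherwise (f_k) would be a Riesz basis; some f_m then has two different square
    summable expansions, with coefficients <g_m, f_k> and delta_mk, whose
    difference is a nontrivial relation. *)
Lemma overcomplete_tail_expansion (I : pred nat) (f : nat -> H) :
  overcomplete_frame ip I f -> exists2 m, I m & tail_expansion I f m.
Proof.
move=> [frm]; apply: contra_notP => notail.
have /is_frame_sums[A [B [s [A0 B0 s_cvg s_ge s_le]]]] := frm.
have /choice[g gP] := frame_expansion_ex ip_norm theta_mul theta_norm K_archi
    A0 B0 s_cvg s_ge s_le.
apply: (@riesz_of_biorthogonal I f (g \o f) frm) => m k Im Ik /=.
apply/eqP; rewrite -subr_eq0; apply/negP => /negP ck.
apply: notail.
pose c j := ip (g (f m)) (f j) - (j == m)%:R.
apply: (@tail_expansion_of_relation I f c (2 * s (g (f m)) + 2)).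
- move=> n; apply: (le_trans (sum_sqr_sub_le _ _ _ _)); apply: lerD.
    by rewrite ler_wpM2l// (sum_le_frame_sum s_cvg).
  rewrite -[leRHS]mulr1 ler_wpM2l//.
  rewrite (eq_bigr (fun j => if j == m then 1 else 0)); last first.
    by move=> j _; case: eqP => _; rewrite ?normr1 ?expr1n ?normr0 ?expr0n.
  by rewrite -big_mkcondr/= (sum_delta (fun=> 1))//; case: ifP.
- suff : (fun n => \sum_(0 <= j < n | I j) c j *: f j) @ \oo --> f m - f m.
    by rewrite subrr.
  apply: (eq_cvgn _ (cvgB (gP (f m)) (@cvg_step K H (f m) m))) => n.
  rewrite !fctE -(sum_delta f n Im) big_mkcondr/= -sumrB.
  apply: eq_bigr => j _; rewrite scalerBl; congr (_ - _).
  by case: eqP; rewrite ?scale1r ?scale0r.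
- by exists k.
Qed.

(** If f_m = sum_(k > m) e_k f_k with sum_k |e_k|^2 <= E, Cauchy-Schwarz bounds
    |<x, f_m>|^2 by E times the frame sum without f_m.  The full frame sum is thus
    at most 1 + E times the reduced one, and the lower bound A becomes A / (1 + E). *)
Lemma is_frame_remove (I : pred nat) (f : nat -> H) (m : nat) :
  is_frame ip I f -> I m -> tail_expansion I f m ->
  is_frame ip (fun k => I k && (k != m)) f.
Proof.
move=> /is_frame_sums[A [B [s [A0 B0 s_cvg s_ge s_le]]]] Im [e [E [eE ef]]].
have E0 : 0 <= E by have := eE 0; rewrite big_geq.
have E1 : 0 < 1 + E by rewrite ltr_wpDr.
exists (A / (1 + E)), B; split=> //; first by rewrite divr_gt0.
(* The frame sum of x after removal of f m. *)
move=> x; pose s' := s x - `|ip x (f m)| ^+ 2.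
have s'_cvg : (fun n => \sum_(0 <= k < n | I k && (k != m)) `|ip x (f k)| ^+ 2)
    @ \oo --> s'.
  apply: (eq_cvgn _ (cvgB (s_cvg x) (@cvg_step K K^o (`|ip x (f m)| ^+ 2) m))).
  move=> n; rewrite !fctE [X in X - _](bigID (fun k => k == m))/=.
  by rewrite (sum_delta (fun k => `|ip x (f k)| ^+ 2))// addrC addrK.
have s'_ge n :
    \sum_(0 <= k < n | I k && (k != m)) `|ip x (f k)| ^+ 2 <= s'.
  apply: (@le_cvg_nondecreasing _ _ _ n _ s'_cvg) => p q pq.
  rewrite [leRHS](big_cat_nat (leq0n p) pq)/= lerDl.
  by apply: sumr_ge0 => k _; rewrite exprn_ge0.
have fm_le : `|ip x (f m)| ^+ 2 <= E * s'.
  have ipn := cvg_ipr ip_norm theta_mul (y := x) ef.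
  have norm_ipn := cvg_comp _ _ ipn (@norm_continuous K K^o (ip x (f m))).
  apply: (cvg_le_bound _ (cvgM norm_ipn norm_ipn)) => n.
  rewrite -[leLHS]expr2 /= ip_sumr.
  under eq_bigr do rewrite ipZr.
  apply: (le_trans (cauchy_schwarz_sum _ _ _ _)); apply: ler_pM.
  - by apply: sumr_ge0 => k _; rewrite exprn_ge0.
  - by apply: sumr_ge0 => k _; rewrite exprn_ge0.
  - by under eq_bigr do rewrite theta_norm; exact: eE.
  apply: (le_trans _ (s'_ge n)).
  rewrite [leRHS](bigID (fun k => (m < k)%N))/=.
  rewrite (eq_bigl (fun k => I k && (k != m) && (m < k)%N)).
    by rewrite lerDl; apply: sumr_ge0 => k _; rewrite exprn_ge0.
  by move=> k; case: (I k) => //=; case: ltngtP.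
exists s' => //; apply/andP; split.
  rewrite mulrAC ler_pdivrMr// (le_trans (s_ge x))// mulrDr mulr1.
  by rewrite -lerBlDl opprB addrC subrK mulrC.
by rewrite (le_trans _ (s_le x))// gerBl exprn_ge0.
Qed.

Lemma tail_expansion_eq (I J : pred nat) (f : nat -> H) (m : nat) :
  (forall k, (m < k)%N -> I k = J k) ->
  tail_expansion I f m -> tail_expansion J f m.
Proof.
move=> IJ [e [E [eE ef]]].
have IJm : (fun k => I k && (m < k)%N) =1 (fun k => J k && (m < k)%N).
  by move=> k; case: (ltnP m k) => [/IJ ->|]; rewrite ?andbF.
exists e, E; split=> [n|]; first by rewrite -(eq_bigl _ _ IJm).
by apply: eq_cvgn ef => n; exact: eq_bigl.
Qed.

(** T moves every index in the expansion up by one, and it commutes with the sum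
    because it is continuous. *)
Lemma tail_expansion_shift (T : {linear H -> H}) (f : nat -> H) (m : nat) :
  bounded_operator T -> (forall k, (m <= k)%N -> T (f k) = f k.+1) ->
  tail_expansion predT f m -> tail_expansion predT f m.+1.
Proof.
move=> T_bdd Tf [e [E [eE ef]]].
(* The term of index 0 is excluded by m + 1 < k, so reindexing loses nothing. *)
have shift (V : zmodType) (F : nat -> V) n :
    \sum_(0 <= k < n.+1 | predT k && (m.+1 < k)%N) F k =
    \sum_(0 <= k < n | predT k && (m < k)%N) F k.+1.
  rewrite big_mkcond big_nat_recl//= add0r [RHS]big_mkcond.
  by apply: eq_bigr.
exists (fun k => e k.-1), E; split=> [[|n]|].
- by have := eE 0; rewrite !big_geq.
- by rewrite shift; exact: eE.
rewrite -cvg_shiftS -(Tf m)//.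
apply: eq_cvgn (bounded_operator_cvg T_bdd ef) => n /=.
rewrite shift raddf_sum; apply: eq_bigr => k /= mk.
by rewrite linearZ/= Tf// ltnW.
Qed.

Lemma is_frame_eq (I J : pred nat) (f : nat -> H) : I =1 J ->
  is_frame ip I f -> is_frame ip J f.
Proof. by move=> /funext ->. Qed.

End RieszDichotomy.

(** * Real and complex scalars *)

Lemma scalars_archi (R : realType) (cplx : bool) (x : scalars R cplx) :
  0 < x -> exists n : nat, x < n%:R.
Proof.
case: cplx x => /= x x_gt0; last first.
  exists (Num.truncn x).+1; exact: truncnS_gt.
move: x_gt0; rewrite ltcE /= => /andP[/eqP imx0 _].
exists (Num.truncn (complex.Re x)).+1.
rewrite -(rmorph_nat (real_complex R)) ltcE /= imx0 eqxx /=.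
exact: truncnS_gt.
Qed.

Lemma scalar_conj_mul (R : realType) (cplx : bool) (z : scalars R cplx) :
  z * scalar_conj z = `|z| ^+ 2.
Proof.
case: cplx z => z /=; first by rewrite -normCK.
by rewrite -normrX ger0_norm ?sqr_ge0// expr2.
Qed.

Lemma norm_scalar_conj (R : realType) (cplx : bool) (z : scalars R cplx) :
  `|scalar_conj z| = `|z|.
Proof. by case: cplx z => z //=; exact: norm_conjC. Qed.

(** * Frames generated by a bounded operator *)

Theorem proposition2p5 (R : realType) (cplx : bool)
    (H : completeNormedModType (scalars R cplx))
    (ip : {dot H for @scalar_conj R cplx})
    (ip_norm : induces_norm ip)
    (H_infdim : infinite_dimensional H)
    (H_sep : separable H)
    (f : nat -> H)
    (f_over : overcomplete_frame ip (fun k => (1 <= k)%N) f)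
    (phi : H) (T : {linear H -> H}) (T_bdd : bounded_operator T)
    (f_orbit : forall n : nat, f n.+1 = iter n T phi) :
  exists2 N : nat, (1 <= N)%N &
    forall l : nat, (1 <= l)%N ->
      is_frame ip (fun k => (1 <= k <= N)%N || (N + l <= k)%N) f.
Proof.
have conj_mul := @scalar_conj_mul R cplx.
have conj_norm := @norm_scalar_conj R cplx.
have Tf k : (1 <= k)%N -> T (f k) = f k.+1.
  by case: k => // k _; rewrite !f_orbit.
have [N N_gt0 tailN] := overcomplete_tail_expansion ip_norm conj_mul conj_norm
  (@scalars_archi R cplx) f_over.
exists N => //.
have tail j : tail_expansion predT f (N + j).
  elim: j => [|j IHj].
    rewrite addn0; apply: tail_expansion_eq tailN => k Nk.
    by rewrite (leq_ltn_trans _ Nk).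
  rewrite addnS; apply: (tail_expansion_shift T_bdd _ IHj) => k Njk.
  by rewrite Tf// (leq_trans N_gt0)// (leq_trans (leq_addr j N)).
elim=> // -[_ _|l IHl _].
  apply: is_frame_eq f_over.1 => k.
  by lia.
have frm := is_frame_remove ip_norm conj_mul conj_norm (IHl isT) (m := (N + l.+1)%N).
apply: is_frame_eq (frm _ _) => [k|/=|].
- by lia.
- by rewrite leqnn orbT.
- apply: tail_expansion_eq (tail l.+1) => k Nlk.
  by rewrite /= (ltnW Nlk) orbT.
Qed.
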